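(* \[ f\left(n,24,\binom{24}{2} - 15\right) = \Omega\left(n^{9/8}\right). \]
   Context: For positive integers $n,k,\ell$, $f(n,k,\ell)$ denotes the minimum number of colors $|C|$ in a coloring $\chi:E\to C$ of the edges of the complete graph $K_n=(V,E)$ such that every set of $k$ vertices of $V$ spans (in the induced complete subgraph $K_k$) edges of at least $\ell$ distinct colors. The asymptotic notation refers to $n\to\infty$. *)

(* Defs.v *)
From mathcomp Require Import all_boot.
Set Implicit Arguments. Unset Strict Implicit. Unset Printing Implicit Defensive.

(* Edge colourings of K_n on vertex set 'I_n with colour set 'I_c.
   A colouring is a function on ordered pairs which is symmetric, so that each
   edge {x,y} (x != y) gets the single colour chi (x,y) = chi (y,x);
   values on the diagonal are irrelevant. *)

Definition sym_col (n c : nat) (chi : {ffun 'I_n * 'I_n -> 'I_c}) : bool :=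
  [forall x : 'I_n, forall y : 'I_n, chi (x, y) == chi (y, x)].

Definition span_colors (n c : nat) (chi : {ffun 'I_n * 'I_n -> 'I_c})
  (S : {set 'I_n}) : {set 'I_c} :=
  [set chi (x, y) | x in S, y in S & x != y].

Definition kl_coloring (n k l c : nat) (chi : {ffun 'I_n * 'I_n -> 'I_c}) : bool :=
  sym_col chi &&
  [forall S : {set 'I_n}, (#|S| == k) ==> (l <= #|span_colors chi S|)].

Definition good (n k l c : nat) : bool :=
  [exists chi : {ffun 'I_n * 'I_n -> 'I_c}, kl_coloring k l chi].

(* f(n,k,l) = least c such that a valid colouring with c colours exists.
   It suffices to search c <= n*n: a colouring giving every edge its own colour
   uses at most n*n colours and spans the maximum possible number of colours in
   every k-set, so if any valid colouring exists, one with <= n*n colours does.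
   If no valid colouring exists at all, the value (n*n).+1 is returned
   (a conventional "infinity"; it does not occur for the parameters used). *)
Definition fnkl (n k l : nat) : nat :=
  find (good n k l) (iota 0 (n * n).+1).

(* Main.v *)
Require Import Defs.
From mathcomp Require Import all_boot all_order all_algebra zify ring lra.
Set Implicit Arguments. Unset Strict Implicit. Unset Printing Implicit Defensive.
Import Order.TTheory GRing.Theory Num.Theory.

(** Call two triples (x_0, x_1, x_2), (y_0, y_1, y_2) of distinct vertices
adjacent when the three edges x_k y_k exist and have the same colour. If few
colours are used, this third colour energy graph on at most n^3 vertices has,
by the power mean inequality, average degree at least a large multiple of
n^(3/4). An 8-cycle in it on pairwise disjoint triples gives 24 vertices of
K_n and 24 edges among them in only 8 colours, i.e. 16 repetitions, which the
colouring forbids.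

Such a cycle is found by a weighted form of Janzer's counting argument. After
passing to a subgraph of minimum degree delta, give a closed 8-walk the product
of the inverse degrees of its vertices. The total weight is at least 1. Monochromatic
stars are bounded, so a triple has only boundedly many neighbours meeting a
given triple, and Cauchy-Schwarz bounds the weight of the walks in which two
triples meet. Inverse degrees as weights make an upper bound on the maximum
degree unnecessary. *)

(** * Weighted closed walks *)

Section Walks.
Local Open Scope ring_scope.
Variables (R : realFieldType).

(* Cauchy-Schwarz without square roots: with a = u^2, b = v^2, g = u v it is the
   usual form, but a and b need not be squares. *)
Lemma sum_sqr_le (I : finType) (P : pred I) (g a b : I -> R) :
  (forall i, P i -> 0 <= a i) -> (forall i, P i -> 0 <= b i) ->
  (forall i, P i -> g i ^+ 2 <= a i * b i) ->
  (\sum_(i | P i) g i) ^+ 2 <= (\sum_(i | P i) a i) * (\sum_(i | P i) b i).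
Proof.
move=> a0 b0 gab.
suff [_ _ //] : [/\ 0 <= \sum_(i | P i) a i, 0 <= \sum_(i | P i) b i &
  (\sum_(i | P i) g i) ^+ 2 <= (\sum_(i | P i) a i) * (\sum_(i | P i) b i)].
apply: (big_ind3 (fun x y z : R => [/\ 0 <= y, 0 <= z & x ^+ 2 <= y * z])).
- by rewrite expr2 !mulr0.
- move=> x y z x' y' z' [y0 z0 xyz] [y'0 z'0 xyz'].
  split; [exact: addr_ge0 | exact: addr_ge0 |].
  have cross : x * x' *+ 2 <= y * z' + y' * z.
    apply: le_trans (ler_norm _) _.
    rewrite -[leRHS]ger0_norm ?addr_ge0 ?mulr_ge0 // -ler_sqr ?nnegrE //.
    rewrite !real_normK ?num_real //.
    have h : x ^+ 2 * x' ^+ 2 <= (y * z) * (y' * z').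
      by apply: ler_pM; rewrite ?sqr_ge0.
    have := sqr_ge0 (y * z' - y' * z); nra.
  nra.
- by move=> i Pi; split; [exact: a0 | exact: b0 | exact: gab].
Qed.

Variables (V : finType) (A : rel V).
Hypothesis symA : symmetric A.

Let a x y : R := (A x y)%:R.
Let d x : R := \sum_y a x y.
(* [mu x = 0] at an isolated vertex [x]. *)
Let mu x : R := (d x)^-1.

(* Walks with [m.+1] edges, weighted at their [m] interior vertices only. *)
Fixpoint walk m y z : R :=
  if m is m'.+1 then \sum_x a y x * mu x * walk m' x z else a y z.

(** The total weight of closed walks with [2 * m + 2] edges, cut at two opposite vertices: the trace
    of that power of the random walk matrix. *)
Definition walk_energy m : R := \sum_y \sum_z mu y * mu z * walk m y z ^+ 2.

Let a_ge0 x y : 0 <= a x y. Proof. exact: ler0n. Qed.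
Let d_ge0 x : 0 <= d x. Proof. exact: sumr_ge0. Qed.
Let mu_ge0 x : 0 <= mu x. Proof. by rewrite invr_ge0. Qed.
Let aC x y : a x y = a y x. Proof. by rewrite /a symA. Qed.
Let a_sqr x y : a x y ^+ 2 = a x y.
Proof. by rewrite /a; case: (A x y); rewrite ?expr1n ?expr0n. Qed.

Lemma walk_ge0 m y z : 0 <= walk m y z.
Proof.
elim: m y z => [|m IH] y z //=.
by apply: sumr_ge0 => x _; rewrite !mulr_ge0.
Qed.

Lemma walkSr m y z : walk m.+1 y z = \sum_x walk m y x * mu x * a x z.
Proof.
elim: m y z => [|m IH] y z //.
rewrite [LHS]/=; under eq_bigr => x _ do rewrite [\sum__ _](IH x z).
under [RHS]eq_bigr => x _ do rewrite /= !mulr_suml.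
rewrite exchange_big /=; apply: eq_bigr => x _; rewrite mulr_sumr.
by apply: eq_bigr => t _; ring.
Qed.

Lemma walk_energy_ge0 m : 0 <= walk_energy m.
Proof. apply: sumr_ge0 => y _; apply: sumr_ge0 => z _.
by apply: mulr_ge0; rewrite ?sqr_ge0 ?mulr_ge0.
Qed.

(** The closed 2-walks at [y] add up to the diagonal term [mu y * walk 1 y y]. Cauchy-Schwarz over
    [y] bounds the squared sum by [#|V|] times the diagonal part of [walk_energy 1]. *)
Lemma walk_energy0_le : walk_energy 0 ^+ 2 <= #|V|%:R * walk_energy 1.
Proof.
have -> : walk_energy 0 = \sum_y mu y * walk 1 y y.
  apply: eq_bigr => y _ /=; rewrite mulr_sumr; apply: eq_bigr => z _.
  by rewrite (aC z y); ring.
have -> : #|V|%:R = \sum_(y : V) (1 : R) by rewrite sumr_const.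
apply: le_trans (sum_sqr_le (a := fun=> 1) (b := fun y => (mu y * walk 1 y y) ^+ 2) _ _ _) _ => //.
- by move=> y _; exact: sqr_ge0.
- by move=> y _; rewrite mul1r.
apply: ler_wpM2l; first exact: sumr_ge0.
apply: ler_sum => y _; rewrite (bigD1 y) //= exprMn.
rewrite -{1}expr2 lerDl; apply: sumr_ge0 => z _.
by apply: mulr_ge0; rewrite ?sqr_ge0 ?mulr_ge0.
Qed.

(** Moving one edge between the two halves of a closed walk turns them into [walk m] and
    [walk m.+2]; then Cauchy-Schwarz applies. *)
Lemma walk_energy_logconvex m :
  walk_energy m.+1 ^+ 2 <= walk_energy m * walk_energy m.+2.
Proof.
have -> : walk_energy m.+1 =
    \sum_(p : V * V) mu p.1 * mu p.2 * (walk m p.1 p.2 * walk m.+2 p.1 p.2).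
  rewrite /walk_energy.
  rewrite -(pair_bigA _ (fun y z => mu y * mu z * (walk m y z * walk m.+2 y z))).
  apply: eq_bigr => y _.
  under [LHS]eq_bigr => z _ do rewrite expr2 {1}walkSr mulr_suml mulr_sumr.
  rewrite exchange_big; apply: eq_bigr => x _ /=.
  rewrite -[\sum_x0 a y x0 * _ * _]/(walk m.+2 y x) walkSr !mulr_sumr.
  by apply: eq_bigr => z _; rewrite (aC x z) -[\sum__ _]/(walk m.+1 y z); ring.
rewrite /walk_energy !pair_bigA /=.
apply: sum_sqr_le => [p _|p _|p _]; try by apply: mulr_ge0; rewrite ?sqr_ge0 ?mulr_ge0.
by rewrite le_eqVlt; apply/orP; left; apply/eqP; ring.
Qed.

(** With energies e_i and N = [#|V|], the first bounds give e1^3 <= N e2^2, and e2^2 <= e1 e3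
    finishes: N acts as a term before e0 in a log-convex sequence. *)
Lemma walk_energy_interp :
  walk_energy 2 ^+ 4 <= #|V|%:R * walk_energy 3 ^+ 3.
Proof.
have := walk_energy0_le; have := walk_energy_logconvex 0.
have := walk_energy_logconvex 1.
move: (walk_energy_ge0 0) (walk_energy_ge0 1) (walk_energy_ge0 2) (walk_energy_ge0 3).
move: (walk_energy 0) (walk_energy 1) (walk_energy 2) (walk_energy 3) => e0 e1 e2 e3.
move: #|V|%:R (ler0n R #|V|) => N N0 e00 e10 e20 e30 h2 h1 h0.
have h13 : e1 ^+ 3 <= N * e2 ^+ 2.
  move: e10; rewrite le_eqVlt => /orP[/eqP<-|e1p].
    by rewrite expr0n mulr_ge0 ?sqr_ge0.
  rewrite -(ler_pM2l e1p).
  have: (e1 ^+ 2) ^+ 2 <= (e0 * e2) ^+ 2.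
    by rewrite ler_pXn2r ?nnegrE ?sqr_ge0 ?mulr_ge0.
  have: e0 ^+ 2 * e2 ^+ 2 <= N * e1 * e2 ^+ 2 by rewrite ler_wpM2r ?sqr_ge0.
  nra.
move: e20; rewrite le_eqVlt => /orP[/eqP<-|e2p].
  by rewrite expr0n mulr_ge0 ?exprn_ge0.
have e22p : 0 < e2 ^+ 2 by rewrite exprn_gt0.
rewrite -(ler_pM2l e22p).
have : (e2 ^+ 2) ^+ 3 <= (e1 * e3) ^+ 3.
  by rewrite ler_pXn2r ?nnegrE ?sqr_ge0 ?mulr_ge0.
have: e1 ^+ 3 * e3 ^+ 3 <= N * e2 ^+ 2 * e3 ^+ 3 by rewrite ler_wpM2r ?exprn_ge0.
rewrite !exprMn => u v.
have -> : e2 ^+ 2 * e2 ^+ 4 = e2 ^+ 3 * e2 ^+ 3 by ring.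
apply: le_trans v (le_trans u _).
by rewrite le_eqVlt; apply/orP; left; apply/eqP; ring.
Qed.

(** At an isolated [x] both sides vanish, so the convention [mu x = 0] does no harm. *)
Let a_mu_d y x : a y x * mu x * d x = a y x.
Proof.
case: (eqVneq (d x) 0) => [dx0|dx]; last by rewrite /mu mulfVK.
rewrite dx0 mulr0 aC.
have /eqP := dx0; rewrite psumr_eq0 // => /allP/(_ y).
by rewrite mem_index_enum => /(_ isT)/eqP.
Qed.

Lemma walk_sum m y : \sum_z walk m y z = d y.
Proof.
elim: m y => [|m IH] y //=; rewrite exchange_big /=.
under eq_bigr => x _ do rewrite -mulr_sumr IH a_mu_d.
by [].
Qed.

(** By [walk_sum] all walks together weigh as much as the degree sum. Cauchy-Schwarz against
    [d y * d z] bounds its square by the energy times that same square. *)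
Lemma walk_energy_ge1 m : (exists x y, A x y) -> 1 <= walk_energy m.
Proof.
case=> x0 [y0 A0].
have D0 : 0 < \sum_x d x.
  rewrite (bigD1 x0) //= ltr_pwDl ?sumr_ge0 //.
  by rewrite /d (bigD1 y0) //= {1}/a A0 ltr_pwDl ?sumr_ge0.
have D20 : 0 < (\sum_x d x) ^+ 2 by rewrite exprn_gt0.
rewrite -(ler_pM2r D20) mul1r.
have {1}-> : \sum_x d x = \sum_(p : V * V) walk m p.1 p.2.
  rewrite -(pair_bigA _ (fun y z => walk m y z)) /=.
  by apply: eq_bigr => y _; rewrite walk_sum.
have -> : (\sum_x d x) ^+ 2 = \sum_(p : V * V) d p.1 * d p.2.
  rewrite -(pair_bigA _ (fun y z => d y * d z)) /= expr2 mulr_suml.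
  by apply: eq_bigr => y _; rewrite mulr_sumr.
rewrite /walk_energy pair_bigA /=; apply: sum_sqr_le => [[y z]|[y z]|[y z]] _ /=.
- by apply: mulr_ge0; rewrite ?sqr_ge0 ?mulr_ge0.
- exact: mulr_ge0.
(* Inserting [mu] and the degree at either end makes the termwise hypothesis an equality, isolated
   vertices included. *)
have muw : walk m y z = walk m y z * mu z * d z.
  case: m => [|m]; first by rewrite /= a_mu_d.
  by rewrite walkSr !mulr_suml; apply: eq_bigr => x _; rewrite -!mulrA (mulrA (a x z)) a_mu_d.
have muw' : walk m y z = walk m y z * mu y * d y.
  case: m {muw} => [|m]; first by rewrite /= aC a_mu_d.
  rewrite /= !mulr_suml; apply: eq_bigr => x _.
  by rewrite -{1}[a y x]aC -(a_mu_d x y) (aC x y); ring.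
rewrite le_eqVlt; apply/orP; left; apply/eqP.
by rewrite expr2 {1}muw {2}muw'; ring.
Qed.

(** * Closed walks of length 8, indexed by the integers modulo 8 *)

Definition cycle_weight (x : {ffun 'I_8 -> V}) : R :=
  \prod_(i < 8) (mu (x i) * a (x i) (x (i + 1))).

Let mk8 x0 x1 x2 x3 x4 x5 x6 x7 : {ffun 'I_8 -> V} :=
  [ffun i : 'I_8 => nth x0 [:: x0; x1; x2; x3; x4; x5; x6; x7] i].

(** The cut points [x7] and [x3] come first, then one half as a block, then the other half starting
    with [x0], the vertex to be restricted. *)
Lemma sum_ffun8 (F : {ffun 'I_8 -> V} -> R) :
  \sum_x F x = \sum_x7 \sum_x3 \sum_(h : V * V * V) \sum_x0 \sum_x1 \sum_x2
    F (mk8 x0 x1 x2 x3 h.1.1 h.1.2 h.2 x7).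
Proof.
pose f (p : V * (V * (V * V * V * (V * (V * V))))) :=
  mk8 p.2.2.2.1 p.2.2.2.2.1 p.2.2.2.2.2 p.2.1 p.2.2.1.1.1 p.2.2.1.1.2 p.2.2.1.2 p.1.
pose o k : 'I_8 := inord k.
pose g (x : {ffun 'I_8 -> V}) :=
  (x (o 7%N), (x (o 3%N), ((x (o 4%N), x (o 5%N), x (o 6%N)), (x (o 0%N), (x (o 1%N), x (o 2%N)))))).
rewrite (reindex f) /=; last first.
  exists g => [p _ | x _].
    by case: p => [x7 [x3 [[[x4 x5] x6] [x0 [x1 x2]]]]]; rewrite /g /f !ffunE !inordK.
  apply/ffunP => i; rewrite ffunE /=.
  by case: i => [[|[|[|[|[|[|[|[|i]]]]]]]] lti] //=; congr (x _); apply: val_inj; rewrite /= inordK.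
rewrite -(pair_bigA _ (fun x7 q => F (f (x7, q)))); apply: eq_bigr => x7 _.
rewrite -(pair_bigA _ (fun x3 q => F (f (x7, (x3, q))))); apply: eq_bigr => x3 _.
rewrite -(pair_bigA _ (fun h q => F (f (x7, (x3, (h, q)))))); apply: eq_bigr => h _.
rewrite -(pair_bigA _ (fun x0 q => F (f (x7, (x3, (h, (x0, q))))))).
apply: eq_bigr => x0 _.
by rewrite -(pair_bigA _ (fun x1 q => F (f (x7, (x3, (h, (x0, (x1, q)))))))).
Qed.

Lemma cycle_weight_mk8 x0 x1 x2 x3 x4 x5 x6 x7 :
  cycle_weight (mk8 x0 x1 x2 x3 x4 x5 x6 x7) =
  mu x7 * mu x3 * (a x7 x6 * mu x6 * (a x6 x5 * mu x5 * (a x5 x4 * mu x4 * a x4 x3))) *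
  (a x7 x0 * mu x0 * (a x0 x1 * mu x1 * (a x1 x2 * mu x2 * a x2 x3))).
Proof.
rewrite /cycle_weight !big_ord_recl big_ord0 !ffunE /=.
rewrite (aC x7 x6) (aC x6 x5) (aC x5 x4) (aC x4 x3).
ring.
Qed.

Lemma cycle_weight_ge0 x : 0 <= cycle_weight x.
Proof. by apply: prodr_ge0 => i _; apply: mulr_ge0. Qed.

(* The path x7 x6 x5 x4 x3 of the closed walk; the rest is x7 x0 x1 x2 x3. *)
Let half x7 x3 (h : V * V * V) : R :=
  a x7 h.2 * mu h.2 * (a h.2 h.1.2 * mu h.1.2 * (a h.1.2 h.1.1 * mu h.1.1 * a h.1.1 x3)).

Let half_ge0 y z h : 0 <= half y z h.
Proof. by rewrite /half !mulr_ge0. Qed.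

Let sum_half y z : \sum_h half y z h = walk 3 y z.
Proof.
rewrite -(pair_bigA _ (fun p x6 => half y z (p, x6))).
rewrite -(pair_bigA _ (fun x4 x5 => \sum_x6 half y z (x4, x5, x6))) /=.
rewrite exchange_big /=.
under eq_bigr => x5 _ do rewrite exchange_big /=.
rewrite exchange_big /=.
apply: eq_bigr => x6 _; rewrite mulr_sumr; apply: eq_bigr => x5 _.
by rewrite !mulr_sumr; apply: eq_bigr => x4 _.
Qed.

(** The condition ignores [x1] and [x2], so summing over them completes the second half to
    [walk 2 x0 z]. *)
Lemma sum_cycle_half (P : V -> V -> V * V * V -> V -> bool) (Q : pred {ffun 'I_8 -> V}) :
  (forall x0 x1 x2 x3 h x7, Q (mk8 x0 x1 x2 x3 h.1.1 h.1.2 h.2 x7) = P x7 x3 h x0) ->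
  \sum_(x | Q x) cycle_weight x =
  \sum_y \sum_z \sum_h \sum_(x0 | P y z h x0)
    mu y * mu z * (half y z h * (a y x0 * mu x0 * walk 2 x0 z)).
Proof.
move=> QP; rewrite big_mkcond sum_ffun8.
apply: eq_bigr => y _; apply: eq_bigr => z _; apply: eq_bigr => h _.
rewrite [RHS]big_mkcond; apply: eq_bigr => x0 _ /=.
case: ifPn => Px; last first.
  by apply: big1 => x1 _; apply: big1 => x2 _; rewrite QP (negbTE Px).
rewrite !mulr_sumr; apply: eq_bigr => x1 _.
rewrite !mulr_sumr; apply: eq_bigr => x2 _.
by rewrite QP Px cycle_weight_mk8 /half /=; ring.
Qed.

Lemma sum_cycle_weight : \sum_x cycle_weight x = walk_energy 3.
Proof.
rewrite (sum_cycle_half (P := fun _ _ _ _ => true)) //.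
apply: eq_bigr => y _; apply: eq_bigr => z _.
under eq_bigr => h _ do rewrite -!mulr_sumr.
by rewrite -mulr_sumr -mulr_suml sum_half expr2.
Qed.

(** * Closed walks containing a conflict *)

Variables (conf : rel V) (s : nat) (delta : R).
Hypothesis symconf : symmetric conf.
Hypothesis hconf : forall u v, (#|[set w | A v w && conf u w]| <= s)%N.
Hypothesis delta0 : 0 < delta.
Hypothesis mu_le : forall x, mu x <= delta^-1.

(* Fix y = x7 and z = x3. For each path y x6 x5 x4 z, at most s neighbours x0 of y
   conflict with the chosen vertex [u] of that path, so Cauchy-Schwarz over x0
   costs a factor s, while the full sum of squares over x0 is smaller by 1/delta
   than the energy one step down. *)
Lemma conf_weight_half (u : V -> V -> V * V * V -> V) :
  (\sum_y \sum_z \sum_h \sum_(x0 | conf (u y z h) x0)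
    mu y * mu z * (half y z h * (a y x0 * mu x0 * walk 2 x0 z))) ^+ 2
  <= walk_energy 3 * (s%:R / delta * walk_energy 2).
Proof.
pose g y z x0 := a y x0 * mu x0 * walk 2 x0 z.
have g0 y z x0 : 0 <= g y z x0 by rewrite /g !mulr_ge0 ?walk_ge0.
have gs y z v : (\sum_(x0 | conf v x0) g y z x0) ^+ 2 <= s%:R * \sum_x0 g y z x0 ^+ 2.
  have -> : \sum_(x0 | conf v x0) g y z x0 =
     \sum_(x0 in [set w | A y w && conf v w]) g y z x0.
    rewrite [LHS]big_mkcond [RHS]big_mkcond; apply: eq_bigr => x0 _.
    by rewrite inE /g /a; case: (A y x0) => //=; rewrite !mul0r if_same.
  apply: le_trans (sum_sqr_le (a := fun=> 1) (b := fun x0 => g y z x0 ^+ 2) _ _ _) _ => //.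
  - by move=> x _; exact: sqr_ge0.
  - by move=> x _; rewrite mul1r.
  apply: ler_pM.
  - exact: sumr_ge0.
  - by apply: sumr_ge0 => x _; exact: sqr_ge0.
  - by rewrite sumr_const ler_nat hconf.
  by rewrite [leRHS](bigID (mem [set w | A y w && conf v w])) /= lerDl sumr_ge0 // => x _; exact: sqr_ge0.
have step : walk_energy 3 * (s%:R * \sum_y \sum_z mu y * mu z * \sum_x0 g y z x0 ^+ 2)
    <= walk_energy 3 * (s%:R / delta * walk_energy 2).
  apply: ler_wpM2l; first exact: walk_energy_ge0.
  rewrite -mulrA; apply: ler_wpM2l; first exact: ler0n.
  rewrite exchange_big mulr_sumr /=.
  under eq_bigr => z _ do under eq_bigr => y _ do rewrite mulr_sumr.
  under eq_bigr => z _ do rewrite exchange_big /=.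
  rewrite exchange_big /=; apply: ler_sum => x0 _.
  rewrite mulr_sumr; apply: ler_sum => z _.
  (* As [a] takes only the values 0 and 1, [y] remains only in [mu y * a x0 y]. Bounding [mu y] by
     [delta^-1] leaves [d x0 * mu x0], which is 0 or 1. *)
  have -> : \sum_y mu y * mu z * g y z x0 ^+ 2 =
      (\sum_y mu y * a x0 y * mu x0) * (mu z * mu x0 * walk 2 x0 z ^+ 2).
    rewrite mulr_suml; apply: eq_bigr => y _.
    by rewrite /g !exprMn a_sqr (aC x0 y); ring.
  have -> : delta^-1 * (mu x0 * mu z * walk 2 x0 z ^+ 2) =
     delta^-1 * (mu z * mu x0 * walk 2 x0 z ^+ 2) by ring.
  apply: ler_wpM2r; first by apply: mulr_ge0; rewrite ?sqr_ge0 ?mulr_ge0.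
  apply: (@le_trans _ _ (\sum_y delta^-1 * a x0 y * mu x0)).
    by apply: ler_sum => y _; rewrite !ler_wpM2r.
  have di0 : 0 <= delta^-1 by rewrite invr_ge0 ltW.
  rewrite -mulr_suml -mulr_sumr -/(d x0) -mulrA ler_piMr //.
  rewrite /mu; case: (eqVneq (d x0) 0) => [->|dx]; first by rewrite mul0r.
  by rewrite mulfV.
apply: le_trans step.
have b0 y z : 0 <= s%:R * (mu y * mu z * \sum_x0 g y z x0 ^+ 2).
  apply: mulr_ge0; rewrite ?ler0n // !mulr_ge0 //; apply: sumr_ge0 => x _; exact: sqr_ge0.
have e0 y z : 0 <= mu y * mu z * walk 3 y z ^+ 2.
  by apply: mulr_ge0; rewrite ?sqr_ge0 ?mulr_ge0.
(* Nested Cauchy-Schwarz over [y], [z] and [h], down to [gs] for the sum over [x0]. *)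
rewrite [s%:R * _]mulr_sumr; apply: sum_sqr_le => y _; rewrite ?[s%:R * _]mulr_sumr.
- by apply: sumr_ge0.
- by apply: sumr_ge0.
apply: sum_sqr_le => z _ //.
under eq_bigr => h _ do rewrite -!mulr_sumr.
rewrite -mulr_sumr exprMn.
suff : (\sum_h half y z h * \sum_(x0 | conf (u y z h) x0) g y z x0) ^+ 2 <=
    walk 3 y z * (walk 3 y z * (s%:R * \sum_x0 g y z x0 ^+ 2)).
  move=> /(ler_wpM2l (sqr_ge0 (mu y * mu z))) /le_trans; apply.
  by rewrite le_eqVlt; apply/orP; left; apply/eqP; ring.
rewrite -sum_half [X in _ <= _ * X]mulr_suml.
apply: sum_sqr_le => [h _|h _|h _]; first exact: half_ge0.
  apply: mulr_ge0; first exact: half_ge0.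
  by rewrite mulr_ge0 ?ler0n ?sumr_ge0 // => x _; exact: sqr_ge0.
rewrite mulrA -expr2 exprMn; apply: ler_wpM2l; [exact: sqr_ge0|exact: gs].
Qed.

Lemma cycle_weight_rot (k : 'I_8) (Q : pred {ffun 'I_8 -> V}) :
  \sum_(x | Q x) cycle_weight x =
  \sum_(x : {ffun 'I_8 -> V} | Q [ffun i => x (i + k)]) cycle_weight x.
Proof.
pose rot k (x : {ffun 'I_8 -> V}) := [ffun i => x (i + k)].
have rotK l : cancel (rot l) (rot (- l)).
  by move=> x; apply/ffunP => i; rewrite !ffunE subrK.
rewrite (reindex (rot k)) /=; last first.
  exists (rot (- k)) => x _; first exact: rotK.
  by rewrite -{1}[k]opprK rotK.
apply: eq_bigr => x _; rewrite /cycle_weight [RHS](reindex_inj (addIr k)).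
by apply: eq_bigr => i _; rewrite !ffunE addrAC.
Qed.

(* One of the two cyclic distances from x_i to x_j is at least 4; rotating puts the
   pair at x_0 and a vertex of the path x3 ... x7. *)
Lemma conf_weight_le (i j : 'I_8) : i != j ->
  (\sum_(x : {ffun 'I_8 -> V} | conf (x i) (x j)) cycle_weight x) ^+ 2 <=
  walk_energy 3 * (s%:R / delta * walk_energy 2).
Proof.
wlog ge3 : i j / (3 <= (j - i)%R)%N => [hwlog ij|_].
  have [/hwlog|lt3] := leqP 3 (j - i)%R; first exact.
  under eq_bigl => x do rewrite symconf.
  apply: hwlog; last by rewrite eq_sym.
  by move: lt3 ij; case: i => [[|[|[|[|[|[|[|[|i]]]]]]]] ?] //;
     case: j => [[|[|[|[|[|[|[|[|j]]]]]]]] ?].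
rewrite (cycle_weight_rot (- i)).
(* Entry 3 is [x3] and entry 7 is [x7]; entries 0 to 2 are fillers, never read since [j - i] is at
   least 3. *)
pose u y z (h : V * V * V) := nth y [:: y; y; y; z; h.1.1; h.1.2; h.2; y] (j - i)%R.
rewrite (sum_cycle_half (P := fun y z h => conf (u y z h))); first exact: conf_weight_half.
move=> x0 x1 x2 x3 h x7; rewrite !ffunE subrr symconf /u.
by move: (j - i) ge3 => [[|[|[|[|[|[|[|[|k]]]]]]]] ?].
Qed.

(** Otherwise every closed walk of positive weight has a conflict at one of at most 64 pairs of
    positions. With T and e2 the energies for 8 and 6 edges and K = s / delta, this gives T <= 64^2
    K e2; interpolation then gives T <= (64^2 K)^4 [#|V|] < 1, against T >= 1. *)
Lemma conf_free_cycle :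
    (exists x y, A x y) -> (64 ^+ 2 * s%:R) ^+ 4 * #|V|%:R < delta ^+ 4 ->
  exists x : {ffun 'I_8 -> V}, (forall i, A (x i) (x (i + 1))) /\
    (forall i j, i != j -> ~~ conf (x i) (x j)).
Proof.
move=> exA hdelta.
case: (pickP (fun x : {ffun 'I_8 -> V} =>
    [forall i, A (x i) (x (i + 1))] && [forall i, forall j, (i != j) ==> ~~ conf (x i) (x j)])).
  move=> x /andP[/forallP Ax /forallP cx]; exists x; split=> // i j ij.
  by move/forallP/(_ j)/implyP: (cx i); apply.
move=> none; exfalso.
pose T := walk_energy 3; pose e2 := walk_energy 2.
have T1 : 1 <= T by exact: walk_energy_ge1.
have e20 : 0 <= e2 by exact: walk_energy_ge0.
pose K := s%:R / delta.
have K0 : 0 <= K by rewrite divr_ge0 // ltW.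
pose B (p : 'I_8 * 'I_8) := \sum_(x : {ffun 'I_8 -> V} | conf (x p.1) (x p.2)) cycle_weight x.
have TB : T <= \sum_(p | p.1 != p.2) B p.
  rewrite /T -sum_cycle_weight /B.
  under [leRHS]eq_bigr => p _ do rewrite big_mkcond.
  rewrite [leRHS]exchange_big /=; apply: ler_sum => x _.
  have := none x; case: (altP forallP) => /= [Ax /negbT|].
    rewrite negb_forall => /existsP[i]; rewrite negb_forall => /existsP[j].
    rewrite negb_imply negbK => /andP[ij cij].
    rewrite (bigD1 (i, j)) //= cij lerDl sumr_ge0 // => p _.
    by case: ifP => // _; exact: cycle_weight_ge0.
  rewrite negb_forall => /existsP[i nAi] _.
  have {1}-> : cycle_weight x = 0.
    by rewrite /cycle_weight (bigD1 i) //= /a (negbTE nAi) mulr0 mul0r.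
  by apply: sumr_ge0 => p _; case: ifP => // _; exact: cycle_weight_ge0.
have T2 : T ^+ 2 <= (64 * T) * (64 * (K * e2)).
  apply: (@le_trans _ _ ((\sum_(p | p.1 != p.2) B p) ^+ 2)).
    rewrite ler_pXn2r ?nnegrE //; first exact: le_trans T1.
    exact: le_trans (le_trans ler01 T1) TB.
  apply: le_trans (sum_sqr_le (a := fun=> T) (b := fun=> K * e2) _ _ _) _.
  - by move=> *; exact: le_trans T1.
  - by move=> *; exact: mulr_ge0.
  - by move=> p pp; exact: conf_weight_le.
  have bound (c : R) : 0 <= c -> \sum_(p : 'I_8 * 'I_8 | p.1 != p.2) c <= 64 * c.
    move=> c0; rewrite sumr_const -[c *+ _]mulr_natl ler_wpM2r // ler_nat.
    by apply: leq_trans (max_card _) _; rewrite card_prod card_ord.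
  have Tge0 : 0 <= T := le_trans ler01 T1.
  have Ke0 : 0 <= K * e2 by exact: mulr_ge0.
  by apply: ler_pM; do [exact: bound | exact: sumr_ge0].
have T0 : 0 < T by exact: lt_le_trans T1.
have Tle : T <= 64 ^+ 2 * K * e2.
  by rewrite -(ler_pM2l T0) -expr2;
    apply: le_trans T2 _; rewrite le_eqVlt; apply/orP; left; apply/eqP; ring.
have T4 : T ^+ 4 <= (64 ^+ 2 * K) ^+ 4 * (#|V|%:R * T ^+ 3).
  apply: (@le_trans _ _ ((64 ^+ 2 * K * e2) ^+ 4)).
    have c0 : 0 <= 64 ^+ 2 * K * e2 := le_trans (ltW T0) Tle.
    by rewrite ler_pXn2r // nnegrE; exact: ltW.
  rewrite exprMn; apply: ler_wpM2l; last exact: walk_energy_interp.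
  by rewrite exprn_ge0 // mulr_ge0 // exprn_ge0.
have T3 : 0 < T ^+ 3 by rewrite exprn_gt0.
have : T <= (64 ^+ 2 * K) ^+ 4 * #|V|%:R by rewrite -(ler_pM2r T3) -exprS -mulrA.
move/(le_trans T1); apply/negP; rewrite -ltNge.
rewrite -(ltr_pM2r (exprn_gt0 4 delta0)) mul1r; apply: le_lt_trans hdelta.
rewrite mulrAC ler_wpM2r // -exprMn /K mulrA mulfVK //.
by rewrite gt_eqF.
Qed.

End Walks.

(** * Passing to large minimum degree *)

(* Take U maximizing e(U) - 2 delta |U|, with e counting ordered adjacent pairs;
   [#|~: U|] avoids the negative sign. *)
Lemma min_degree_subset (V : finType) (A : rel V) (delta : nat) :
    symmetric A -> 2 * delta * #|V| < \sum_x #|[set y | A x y]| ->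
  exists2 U : {set V}, U != set0 &
    forall x, x \in U -> delta <= #|[set y in U | A x y]|.
Proof.
move=> symA dense.
pose e (U : {set V}) := \sum_(x in U) \sum_(y in U) A x y.
have degE (U : {set V}) x : #|[set y in U | A x y]| = \sum_(y in U) A x y.
  rewrite -sum1_card [LHS]big_mkcond [RHS]big_mkcond /=.
  by apply: eq_bigr => y _; rewrite inE; case: (y \in U); case: (A x y).
case: (@arg_maxnP _ [set: V] predT (fun U => e U + 2 * delta * #|~: U|) isT).
move=> U _ maxU; exists U.
  (* If [U] were empty, density would make the full vertex set strictly better. *)
  apply/negP => /eqP U0; have /= := maxU setT isT; rewrite /geq /=.
  rewrite /e U0 big_set0 setCT cards0 muln0 addn0 setC0 cardsT add0n leqNgt.
  apply/negP; rewrite negbK; apply: leq_trans dense _.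
  rewrite leq_eqVlt; apply/orP; left; apply/eqP; rewrite [RHS]big_mkcond /=.
  apply: eq_bigr => x _; rewrite in_setT -degE; congr #|pred_of_set _|.
  by apply/setP => y; rewrite !inE.
move=> x xU; rewrite degE.
(* Deleting [x] gains [2 * delta] from the complement and loses at most twice the degree of [x] in
   [U]. *)
have /= := maxU (U :\ x) isT; rewrite /geq /=.
have -> : #|~: (U :\ x)| = #|~: U|.+1.
  have := cardsC U; have := cardsC (U :\ x); have := cardsD1 x U; rewrite xU; lia.
suff : e U <= 2 * (\sum_(y in U) A x y) + e (U :\ x) by lia.
rewrite {1}/e (big_setD1 x) //= mulSn mul1n -addnA leq_add2l.
have split z : \sum_(y in U) A z y = A z x + \sum_(y in U :\ x) A z y.
  by rewrite (big_setD1 x).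
rewrite (eq_bigr _ (fun z _ => split z)) big_split /= leq_add2r.
rewrite [leqRHS]split; apply: leq_trans (leq_addl _ _).
by apply: leq_sum => z _; rewrite symA.
Qed.

(** Restricting [A] to [U] but keeping the type [V] makes the other vertices isolated. Their inverse
    degree is 0, so the bound on inverse degrees holds everywhere. *)
Lemma dense_conf_free_cycle (V : finType) (A conf : rel V) (s delta : nat) :
    symmetric A -> symmetric conf ->
    (forall u v, #|[set w | A v w && conf u w]| <= s) ->
    2 * delta * #|V| < \sum_x #|[set y | A x y]| ->
    (64 ^ 2 * s) ^ 4 * #|V| < delta ^ 4 ->
  exists x : {ffun 'I_8 -> V}, (forall i, A (x i) (x (i + 1)%R)) /\
    (forall i j, i != j -> ~~ conf (x i) (x j)).
Proof.
move=> symA symconf hconf dense hdelta.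
have [U /set0Pn[x0 x0U] degU] := min_degree_subset symA dense.
have delta_gt0 : 0 < delta.
  by case: delta hdelta {degU dense} => //; rewrite exp0n // ltn0.
pose A' x y := [&& x \in U, y \in U & A x y].
have sum_A' x : (\sum_y (A' x y)%:R = (if x \in U then #|[set y in U | A x y]|%:R else 0) :> rat)%R.
  rewrite -natr_sum; case: ifPn => xU; last first.
    by rewrite big1 // => y _; rewrite /A' (negbTE xU).
  congr (_%:R)%R; rewrite -sum1_card [RHS]big_mkcond /=; apply: eq_bigr => y _.
  by rewrite inE /A' xU /=; case: (_ && _).
have delta0 : (0 < (delta%:R : rat))%R by rewrite ltr0n.
have symA' : symmetric A' by move=> x y; rewrite /A' symA andbCA.
have hconf' u v : #|[set w | A' v w && conf u w]| <= s.
  apply: leq_trans (hconf u v); apply: subset_leq_card.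
  by apply/subsetP => w; rewrite !inE => /andP[/and3P[_ _ ->]].
have mu_le x : ((\sum_y (A' x y)%:R)^-1 <= (delta%:R : rat)^-1)%R.
  rewrite sum_A'; case: ifPn => xU; last by rewrite invr0 invr_ge0 ltW.
  rewrite lef_pV2 ?posrE // ?ltr0n ?ler_nat ?degU //.
  exact: leq_trans delta_gt0 (degU _ xU).
have exA' : exists x y, A' x y.
  have := degU _ x0U; case: (set_0Vmem [set y in U | A x0 y]) => [->|[y]].
    by rewrite cards0 leqNgt delta_gt0.
  by rewrite inE => /andP[yU Ay] _; exists x0, y; rewrite /A' x0U yU.
have cast (k : nat) : (k ^ 2 * s) ^ 4 * #|V| < delta ^ 4 ->
    ((k%:R ^+ 2 * s%:R) ^+ 4 * #|V|%:R < (delta%:R : rat) ^+ 4)%R.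
  by rewrite -(ltr_nat rat) !(natrM, natrX).
have [x [Ax cx]] := conf_free_cycle symA' symconf hconf' delta0 mu_le exA' (cast _ hdelta).
by exists x; split => // i; have /and3P[] := Ax i.
Qed.

(** * Repeated colours *)

Lemma exists_superset_card (T : finType) (S : {set T}) k :
  #|S| <= k <= #|T| -> exists2 S' : {set T}, S \subset S' & #|S'| = k.
Proof.
move=> /andP[Sk kT].
have := cardsC S => cSC.
pose D := [set x in take (k - #|S|) (enum (~: S))].
exists (S :|: D); first exact: subsetUl.
rewrite cardsU disjoint_setI0; last first.
  rewrite disjoints_subset; apply/subsetP => x xS; rewrite !inE.
  by apply/negP => /mem_take; rewrite mem_enum inE xS.
rewrite cards0 subn0 cardsE (card_uniqP _) ?take_uniq ?enum_uniq //.
by rewrite size_takel -?cardE; lia.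
Qed.

Lemma set2_eq (T : finType) (a b c d : T) :
  [set a; b] = [set c; d] -> (a = c /\ b = d) \/ (a = d /\ b = c).
Proof.
move=> E.
have : a \in [set c; d] by rewrite -E set21.
have : b \in [set c; d] by rewrite -E set22.
have : c \in [set a; b] by rewrite E set21.
have : d \in [set a; b] by rewrite E set22.
rewrite !inE.
do 4!case/orP => /eqP ?; subst; auto.
Qed.

Section Coloring.
Variables (n c : nat) (chi : {ffun 'I_n * 'I_n -> 'I_c}).
Hypothesis symchi : sym_col chi.

Let chiC x y : chi (x, y) = chi (y, x).
Proof. by have /forallP/(_ x)/forallP/(_ y)/eqP := symchi. Qed.

Definition edge_colors (F : {set {set 'I_n}}) : {set 'I_c} :=
  [set chi p | p : 'I_n * 'I_n & (p.1 != p.2) && ([set p.1; p.2] \in F)].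

Lemma card_edge_colors F : #|edge_colors F| <= #|F|.
Proof.
rewrite -(card_imset _ (@Some_inj _)).
(* An unordered pair is coloured through any ordering of it; the option covers members of [F] that
   are not pairs. *)
pose col (e : {set 'I_n}) :=
  omap chi [pick p : 'I_n * 'I_n | (p.1 != p.2) && ([set p.1; p.2] == e)].
apply: leq_trans (leq_imset_card col F); apply: subset_leq_card.
apply/subsetP => _ /imsetP[_ /imsetP[[x y] xyF ->] ->].
move: xyF; rewrite inE => /andP[/= xy xyF].
apply/imsetP; exists [set x; y] => //; rewrite /col.
case: pickP => [[x' y'] /= /andP[_ /eqP/set2_eq[[-> ->]|[-> ->]]] //|/(_ (x, y)) /=].
  by rewrite chiC.
by rewrite xy eqxx.
Qed.

(** Enlarge [S] to [k] vertices. Each edge outside [F] adds at most one colour, so [F] has at most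
    ['C(k, 2) - l] repetitions. *)
Lemma kl_coloring_repeats k l (S : {set 'I_n}) (F : {set {set 'I_n}}) :
    kl_coloring k l chi -> #|S| <= k <= n ->
    (forall e, e \in F -> e \subset S /\ #|e| = 2) ->
  l + #|F| <= #|edge_colors F| + 'C(k, 2).
Proof.
move=> /andP[_ /forallP kl] Sk FS.
have [|S' SS' cS'] := @exists_superset_card _ S k; first by rewrite card_ord.
have := kl S'; rewrite cS' eqxx /= => lS'.
pose E := [set e : {set 'I_n} | (e \subset S') && (#|e| == 2)].
have cE : #|E| = 'C(k, 2) by rewrite cards_draws cS'.
have FE : F \subset E.
  apply/subsetP => e /FS[eS /eqP e2]; rewrite inE e2 andbT.
  exact: subset_trans eS SS'.
have spanE : span_colors chi S' \subset edge_colors F :|: edge_colors (E :\: F).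
  apply/subsetP => _ /imset2P[x y xS yS ->].
  move: yS; rewrite inE => /andP[yS xy].
  have xyE : [set x; y] \in E by rewrite inE cards2 xy subUset !sub1set xS yS.
  rewrite inE; apply/orP; have [xyF|xyF] := boolP ([set x; y] \in F).
    by left; apply/imsetP; exists (x, y); rewrite // inE xy xyF.
  by right; apply/imsetP; exists (x, y); rewrite // inE xy in_setD xyF xyE.
have h1 := leq_trans lS' (subset_leq_card spanE).
have h2 := leq_trans h1 (leq_card_setU _ _).1.
have h3 := card_edge_colors (E :\: F); rewrite cardsD (setIidPr FE) cE in h3.
have h4 := subset_leq_card FE; rewrite cE in h4.
move: h2 h3 h4; move: #|edge_colors F| #|edge_colors _| #|F| 'C(k, 2) => a b f e; lia.
Qed.

Hypothesis n24 : 24 <= n.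
Hypothesis kl : kl_coloring 24 ('C(24, 2) - 15) chi.

Lemma kl_coloring24_repeats (S : {set 'I_n}) (F : {set {set 'I_n}}) :
    #|S| <= 24 -> (forall e, e \in F -> e \subset S /\ #|e| = 2) ->
  #|F| <= #|edge_colors F| + 15.
Proof.
move=> S24 FS.
have := kl_coloring_repeats kl _ FS; rewrite S24 n24 => /(_ isT).
have : 15 <= 'C(24, 2) by rewrite bin2.
by move: 'C(24, 2) #|F| #|edge_colors F| => b f e; lia.
Qed.

Definition color_nbr q x := [set y | (x != y) && (chi (x, y) == q)].

(** Seventeen edges of one colour at [x] would be 16 repetitions on 18 vertices, one too many. *)
Lemma color_degree q x : #|color_nbr q x| <= 16.
Proof.
rewrite leqNgt; apply/negP => gt16.
pose B := [set y in take 17 (enum (color_nbr q x))].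
have BN y : y \in B -> (x != y) && (chi (x, y) == q).
  by rewrite inE => /mem_take; rewrite mem_enum inE.
have cB : #|B| = 17.
  by rewrite cardsE (card_uniqP _) ?take_uniq ?enum_uniq // size_takel -?cardE.
pose F := [set [set x; y] | y in B].
have cF : #|F| = 17.
  rewrite card_in_imset // => y z /BN/andP[xy _] _ /set2_eq[[]//|[xz yx]].
  by rewrite yx eqxx in xy.
have colF : edge_colors F \subset [set q].
  apply/subsetP => _ /imsetP[[y z] yzF ->].
  move: yzF; rewrite inE => /andP[/= yz /imsetP[t /BN/andP[_ /eqP xt]]].
  by rewrite inE => /set2_eq[[-> ->]|[-> ->]]; rewrite ?[chi (t, x)]chiC xt.
have h := kl_coloring24_repeats (S := x |: B) (F := F).
have c1 := subset_leq_card colF; rewrite cards1 in c1.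
rewrite cF cardsU1 cB in h.
suff : 17 <= #|edge_colors F| + 15 by lia.
apply: h; first by case: (_ \notin _).
move=> _ /imsetP[y yB ->]; have /andP[xy _] := BN _ yB.
by rewrite cards2 xy setUS // sub1set.
Qed.

Lemma no_color_cycle (x : {ffun 'I_8 -> {ffun 'I_3 -> 'I_n}}) :
    (forall i k, x i k != x (i + 1)%R k) ->
    (forall i k l, chi (x i k, x (i + 1)%R k) = chi (x i l, x (i + 1)%R l)) ->
  ~ injective (fun p : 'I_8 * 'I_3 => x p.1 p.2).
Proof.
move=> xne xcol xinj.
pose w (p : 'I_8 * 'I_3) := x p.1 p.2.
pose sh (p : 'I_8 * 'I_3) := ((p.1 + 1)%R, p.2).
pose F := [set [set w p; w (sh p)] | p : 'I_8 * 'I_3].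
have cF : #|F| = 24.
  rewrite card_imset ?card_prod ?card_ord // => p q /set2_eq[[/xinj //]|].
  case=> /xinj E1 /xinj E2.
  (* Two edges coinciding with ends reversed would force i + 2 = i modulo 8. *)
  have : (q.1 + 1 + 1 = q.1)%R by rewrite -[q in RHS]E2 E1.
  by case: q.1 => [[|[|[|[|[|[|[|[|j]]]]]]]] ltj].
have colF : edge_colors F \subset [set chi (x i ord0, x (i + 1)%R ord0) | i : 'I_8].
  apply/subsetP => _ /imsetP[[y z] yzF ->].
  move: yzF; rewrite inE => /andP[/= yz /imsetP[[i k] _ E]].
  apply/imsetP; exists i => //; rewrite (xcol i ord0 k).
  by case/set2_eq: E => [[-> ->]|[-> ->]] //; rewrite chiC.
have := kl_coloring24_repeats (S := [set w p | p : 'I_8 * 'I_3]) (F := F).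
have := leq_trans (subset_leq_card colF) (leq_imset_card _ _).
rewrite card_ord cF => c8 h.
suff : 24 <= #|edge_colors F| + 15 by lia.
apply: h.
  by apply: leq_trans (leq_imset_card _ _) _; rewrite card_prod !card_ord.
move=> _ /imsetP[p _ ->]; rewrite cards2 (xne p.1 p.2 : w p != w (sh p)).
by split=> //; rewrite subUset !sub1set !imset_f.
Qed.

End Coloring.

(** * The colour energy graph *)

(** Choose greedily: each earlier choice excludes at most [b] elements of [D], so at least
    [#|D| - 2 * b] remain at every stage. *)
Lemma card_compatible_triples (T : finType) (D : {set T}) (bad : rel T) b :
    (forall e, #|[set f in D | bad e f]| <= b) ->
  (#|D| - 2 * b) ^ 3 <=
  #|[set t : T * T * T | [&& t.1.1 \in D, t.1.2 \in D, t.2 \in D,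
      ~~ bad t.1.1 t.1.2, ~~ bad t.1.1 t.2 & ~~ bad t.1.2 t.2]]|.
Proof.
move=> hb; set m := #|D| - 2 * b.
pose D2 e := [set f in D | ~~ bad e f].
pose D3 e f := [set g in D | ~~ bad e g & ~~ bad f g].
have cD2 e : m <= #|D2 e|.
  have := hb e; have := cardsID [set f | bad e f] D.
  have -> : D :&: [set f | bad e f] = [set f in D | bad e f] by apply/setP => f; rewrite !inE.
  have -> : D :\: [set f | bad e f] = D2 e by apply/setP => f; rewrite !inE andbC.
  by rewrite /m; lia.
have cD3 e f : m <= #|D3 e f|.
  have := hb f; have := hb e; have := cardsID [set g | bad e g || bad f g] D.
  have -> : D :&: [set g | bad e g || bad f g] = [set g in D | bad e g] :|: [set g in D | bad f g].
    by apply/setP => g; rewrite !inE andb_orr.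
  have -> : D :\: [set g | bad e g || bad f g] = D3 e f.
    by apply/setP => g; rewrite !inE negb_or andbC.
  have := (leq_card_setU [set g in D | bad e g] [set g in D | bad f g]).1.
  by rewrite /m; lia.
have -> : m ^ 3 = m * (m * m) by rewrite !expnS expn0 muln1.
apply: (@leq_trans (\sum_(e in D) \sum_(f in D2 e) \sum_(g in D3 e f) 1)).
  apply: (@leq_trans (\sum_(e in D) m * m)).
    by rewrite sum_nat_const leq_mul2r leq_subr orbT.
  apply: leq_sum => e _; apply: (@leq_trans (\sum_(f in D2 e) m)).
    by rewrite sum_nat_const leq_mul2r cD2 orbT.
  by apply: leq_sum => f _; rewrite sum1_card.
rewrite -sum1_card pair_big_dep pair_big_dep /=.
rewrite leq_eqVlt; apply/orP; left; apply/eqP; apply: eq_bigl => -[[e f] g] /=.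
by rewrite !inE /=; case: (e \in D); case: (f \in D); case: (g \in D); case: (bad e f); case: (bad e g).
Qed.

(** With S_k the sum of k-th powers, Cauchy-Schwarz gives S1^2 <= [#|I|] S2 and S2^2 <= S1 S3;
    eliminate S2 and cancel S1. *)
Lemma sum_cube_le (I : finType) (f : I -> nat) :
  (\sum_i f i) ^ 3 <= #|I| ^ 2 * \sum_i f i ^ 3.
Proof.
have [->//|S0] := posnP (\sum_i f i).
rewrite -(leq_pmul2l S0) -expnS.
have h1 : (\sum_i f i) ^ 2 <= #|I| * \sum_i f i ^ 2.
  rewrite -(ler_nat rat) natrX natrM !natr_sum.
  have -> : (#|I|%:R = \sum_(i : I) 1 :> rat)%R by rewrite sumr_const.
  apply: sum_sqr_le => i _; rewrite ?ler0n //.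
  by rewrite mul1r natrX.
have h2 : (\sum_i f i ^ 2) ^ 2 <= (\sum_i f i) * \sum_i f i ^ 3.
  rewrite -(ler_nat rat) natrX natrM !natr_sum.
  apply: sum_sqr_le => i _; rewrite ?ler0n //.
  by rewrite -natrX -natrM -expnM -expnS.
apply: (@leq_trans ((#|I| * \sum_i f i ^ 2) ^ 2)).
  have -> : (\sum_i f i) ^ 4 = ((\sum_i f i) ^ 2) ^ 2 by rewrite -(expnM _ 2 2).
  by rewrite leq_exp2r.
by rewrite expnMn mulnCA leq_mul2l h2 orbT.
Qed.

Section EnergyGraph.
Variables (n c : nat) (chi : {ffun 'I_n * 'I_n -> 'I_c}).
Hypothesis n24 : 24 <= n.
Hypothesis kl : kl_coloring 24 ('C(24, 2) - 15) chi.

Let symchi : sym_col chi. Proof. by case/andP: kl. Qed.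
Let chiC x y : chi (x, y) = chi (y, x).
Proof. by have /forallP/(_ x)/forallP/(_ y)/eqP := symchi. Qed.

Local Notation triple := {ffun 'I_3 -> 'I_n}.

Definition energy_edge (x y : triple) : bool :=
  [&& injectiveb x, injectiveb y &
   [forall k, (x k != y k) && (chi (x k, y k) == chi (x ord0, y ord0))]].

Definition share_vertex (x y : triple) : bool := [exists k, exists l, x k == y l].

Lemma energy_edgeC : symmetric energy_edge.
Proof.
move=> x y; rewrite /energy_edge andbCA; congr [&& _, _ & _].
by apply: eq_forallb => k; rewrite eq_sym [chi (y k, _)]chiC [chi (y _, _)]chiC.
Qed.

Lemma share_vertexC : symmetric share_vertex.
Proof.
move=> x y; apply/existsP/existsP => -[k /existsP[l E]];
  by exists l; apply/existsP; exists k; rewrite eq_sym.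
Qed.

(** There are 9 choices of indices with u_k = w_l. Each fixes the common colour as that of the edge
    v_l u_k, leaving at most 16 values for each coordinate of [w]. *)
Lemma card_meeting_neighbours u v :
  #|[set w | energy_edge v w && share_vertex u w]| <= 9 * 16 ^ 3.
Proof.
pose N (p : 'I_3 * 'I_3) : {set triple} :=
  [set w in family (fun k => mem (color_nbr chi (chi (v p.2, u p.1)) (v k)))].
have sub : [set w | energy_edge v w && share_vertex u w] \subset \bigcup_p N p.
  apply/subsetP => w; rewrite inE => /andP[/and3P[_ _ /forallP vw] /existsP[k /existsP[l /eqP E]]].
  apply/bigcupP; exists (k, l) => //; rewrite inE; apply/familyP => j /=.
  have /andP[vwj /eqP cj] := vw j; have /andP[_ /eqP cl] := vw l.
  by rewrite !inE vwj E cl cj eqxx.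
apply: leq_trans (subset_leq_card sub) _.
apply: (@leq_trans (\sum_p #|N p|)).
  elim/big_ind2: _ => [|B b C c' hB hC|//]; first by rewrite cards0.
  exact: leq_trans (leq_card_setU _ _).1 (leq_add hB hC).
apply: (@leq_trans (\sum_(p : 'I_3 * 'I_3) 16 ^ 3)); last first.
  by rewrite sum_nat_const card_prod card_ord.
apply: leq_sum => p _; rewrite cardsE card_family foldrE big_map big_enum /=.
apply: (@leq_trans (\prod_(k : 'I_3) 16)); last by rewrite prod_nat_const card_ord.
by apply: leq_prod => k _; exact: color_degree.
Qed.

Lemma meeting_free_bound (delta : nat) :
    2 * delta * n ^ 3 < \sum_x #|[set y | energy_edge x y]| ->
  delta ^ 4 <= (64 ^ 2 * (9 * 16 ^ 3)) ^ 4 * n ^ 3.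
Proof.
have cV : #|{: triple}| = n ^ 3 by rewrite card_ffun !card_ord.
rewrite -cV => dense; rewrite leqNgt; apply/negP => hdelta.
have [x [Ax mx]] :=
  dense_conf_free_cycle energy_edgeC share_vertexC card_meeting_neighbours dense hdelta.
have edge i k : (x i k != x (i + 1)%R k) &&
    (chi (x i k, x (i + 1)%R k) == chi (x i ord0, x (i + 1)%R ord0)).
  by have /and3P[_ _ /forallP] := Ax i; apply.
apply: (no_color_cycle symchi n24 kl (x := x)).
- by move=> i k; case/andP: (edge i k).
- by move=> i k l; have /andP[_ /eqP->] := edge i k; have /andP[_ /eqP->] := edge i l.
(* Equal vertices at different positions would be a conflict; at one position the triple is
   injective. *)
move=> [i k] [j l] /= E; have [ij|/mx/negP[]] := eqVneq i j.
  have /and3P[/injectiveP inj _ _] := Ax i.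
  by rewrite -ij in E *; rewrite (inj _ _ E).
by apply/existsP; exists k; apply/existsP; exists l; rewrite E.
Qed.

Definition color_class q := [set p : 'I_n * 'I_n | (p.1 != p.2) && (chi p == q)].

Lemma sum_color_class : \sum_q #|color_class q| = n * n - n.
Proof.
have cD : #|[set p : 'I_n * 'I_n | p.1 == p.2]| = n.
  have -> : [set p : 'I_n * 'I_n | p.1 == p.2] = [set (i, i) | i : 'I_n].
    apply/setP => -[i j]; rewrite inE /=; apply/eqP/imsetP => [->|[k _ [-> ->]] //].
    by exists j.
  by rewrite card_imset ?card_ord // => i j [].
have := cardsC [set p : 'I_n * 'I_n | p.1 == p.2].
rewrite cD card_prod !card_ord => E.
rewrite -E addKn -sum1_card (partition_big chi predT) //=.
apply: eq_bigr => q _; rewrite -sum1_card; apply: eq_bigl => p.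
by rewrite !inE.
Qed.

(** Three ordered edges of one colour with distinct first ends and distinct second ends form an
    adjacent pair of triples. An edge shares such an end with at most 16 + 16 members of its class,
    hence 64 = 2 * 32. *)
Lemma card_energy_edges :
  \sum_q (#|color_class q| - 64) ^ 3 <= \sum_x #|[set y | energy_edge x y]|.
Proof.
pose bad (e f : 'I_n * 'I_n) := (e.1 == f.1) || (e.2 == f.2).
pose x (t : ('I_n * 'I_n) * ('I_n * 'I_n) * ('I_n * 'I_n)) : triple :=
  [ffun k : 'I_3 => nth t.2.1 [:: t.1.1.1; t.1.2.1] k].
pose y (t : ('I_n * 'I_n) * ('I_n * 'I_n) * ('I_n * 'I_n)) : triple :=
  [ffun k : 'I_3 => nth t.2.2 [:: t.1.1.2; t.1.2.2] k].
pose T := [set t | energy_edge (x t) (y t)].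
apply: (@leq_trans #|T|); last first.
  have -> : \sum_x #|[set y | energy_edge x y]| = #|[set p | energy_edge p.1 p.2]|.
    rewrite -[RHS]sum1_card.
    under eq_bigr => z _ do rewrite -sum1_card.
    by rewrite pair_big_dep /=; apply: eq_bigl => -[z w]; rewrite !inE.
  have inj : injective (fun t => (x t, y t)).
    move=> t t' [/ffunP Ex /ffunP Ey].
    move: (Ex (inord 0)) (Ex (inord 1)) (Ex (inord 2)).
    move: (Ey (inord 0)) (Ey (inord 1)) (Ey (inord 2)).
    rewrite !ffunE !inordK //= {Ex Ey}.
    by case: t t' => [[[? ?] [? ?]] [? ?]] [[[? ?] [? ?]] [? ?]] /= -> -> -> -> -> ->.
  rewrite -(card_imset _ inj); apply: subset_leq_card.
  by apply/subsetP => _ /imsetP[t tT ->]; move: tT; rewrite !inE.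
rewrite -sum1_card (partition_big (fun t => chi t.1.1) predT) //=.
apply: leq_sum => q _; rewrite sum1_card.
have badD e : #|[set f in color_class q | bad e f]| <= 32.
  have sub : [set f in color_class q | bad e f] \subset
     (fun z => (e.1, z)) @: color_nbr chi q e.1 :|: (fun z => (z, e.2)) @: color_nbr chi q e.2.
    apply/subsetP => -[z w]; rewrite !inE /bad /= => /andP[/andP[zw cq] /orP[/eqP E|/eqP E]].
      by apply/orP; left; apply/imsetP; exists w; rewrite ?E // inE zw cq.
    by apply/orP; right; apply/imsetP; exists z; rewrite ?E // inE eq_sym zw chiC cq.
  apply: leq_trans (subset_leq_card sub) _.
  apply: leq_trans (leq_card_setU _ _).1 _.
  have cn z : #|color_nbr chi q z| <= 16 by exact: color_degree.
  by apply: (@leq_add _ _ 16 16); apply: leq_trans (leq_imset_card _ _) (cn _).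
apply: leq_trans (card_compatible_triples badD) _.
apply: subset_leq_card; apply/subsetP => -[[[a1 b1] [a2 b2]] [a3 b3]].
rewrite !inE /bad !negb_or /=.
case/and5P=> /andP[ab1 c1] /andP[ab2 c2] /andP[ab3 c3] /andP[a12 b12] /andP[/andP[a13 b13] /andP[a23 b23]].
rewrite unfold_in /= c1 andbT inE /energy_edge; apply/and3P; split.
- apply/injectiveP => i j; rewrite !ffunE /=.
  case: i j => [[|[|[|?]]] ?] [[|[|[|?]]] ?] //= E; try exact: val_inj;
  by move: a12 a13 a23; rewrite E eqxx.
- apply/injectiveP => i j; rewrite !ffunE /=.
  case: i j => [[|[|[|?]]] ?] [[|[|[|?]]] ?] //= E; try exact: val_inj;
  by move: b12 b13 b23; rewrite E eqxx.
apply/forallP => k; rewrite !ffunE /= (eqP c1).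
by case: k => [[|[|[|?]]] ?] //=; rewrite ?ab1 ?ab2 ?ab3 ?c1 ?c2 ?c3.
Qed.

End EnergyGraph.

(** * The lower bound *)

(** Take the least [delta] above kappa n^(3/4). Minimality bounds [delta.-1] from above, and
    [delta <= 2 * delta.-1] turns the factor 16 into 32; the second claim is compared in fourth
    powers. *)
Lemma exists_degree_threshold (kappa B n c : nat) :
    0 < kappa -> 1 < n -> 32 <= B -> B ^ 8 * (kappa ^ 4 * c ^ 8) < n ^ 9 ->
  exists2 delta, kappa ^ 4 * n ^ 3 < delta ^ 4 & 16 * delta * c ^ 2 < n ^ 3.
Proof.
move=> k0 n1 B32 hc.
have n0 : 0 < n by exact: ltnW.
have ex : exists d, kappa ^ 4 * n ^ 3 < d ^ 4.
  exists (kappa * n); rewrite expnMn ltn_pmul2l ?expn_gt0 ?k0 //.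
  by rewrite ltn_exp2l.
case: (ex_minnP ex) => d hd mind; exists d => //.
have d1 : 1 < d.
  case: d hd {mind} => [|[|//]]; rewrite ?exp0n ?exp1n // => h.
  suff : 0 < kappa ^ 4 * n ^ 3 by lia.
  by rewrite muln_gt0 !expn_gt0 k0 n0.
have dpred : d.-1 ^ 4 <= kappa ^ 4 * n ^ 3.
  by rewrite leqNgt; apply/negP => /mind; lia.
have : (16 * d * c ^ 2) ^ 4 < (n ^ 3) ^ 4; last by rewrite ltn_exp2r.
apply: (@leq_ltn_trans ((B * d.-1 * c ^ 2) ^ 4)).
  rewrite leq_exp2r // leq_mul2r; apply/orP; right.
  apply: (@leq_trans (32 * d.-1)); last by rewrite leq_mul2r B32 orbT.
  by lia.
rewrite (expnMn (B * _)) (expnMn B) -(expnM c 2 4) -(expnM n 3 4).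
apply: (@leq_ltn_trans (B ^ 4 * (kappa ^ 4 * n ^ 3) * c ^ 8)).
  by rewrite leq_mul2r leq_mul2l dpred !orbT.
have swap p q r t : p * (q * r) * t = p * (q * t) * r by rewrite !mulnA mulnAC.
rewrite swap.
rewrite (_ : 3 * 4 = 9 + 3) // expnD ltn_pmul2r ?expn_gt0 ?n0 //.
apply: leq_ltn_trans hc; rewrite leq_mul2r; apply/orP; right.
by rewrite leq_exp2l //; lia.
Qed.

(** With fewer colours, the power mean inequality over colour classes gives more than
    [2 * delta * n ^ 3] ordered adjacent pairs, for a [delta] that [meeting_free_bound] rules
    out. *)
Lemma good_lower_bound n c : 24 <= n -> good n 24 ('C(24, 2) - 15) c ->
  n ^ 9 <= 256 ^ 8 * ((64 ^ 2 * (9 * 16 ^ 3)) ^ 4 * c ^ 8).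
Proof.
move=> n24 /existsP[chi kl].
have := @meeting_free_bound n c chi n24 kl.
have : 0 < 64 ^ 2 * (9 * 16 ^ 3) by rewrite muln_gt0 expn_gt0 muln_gt0 expn_gt0.
move: (64 ^ 2 * (9 * 16 ^ 3)) => kappa k0 bound.
have : 256 <= 256 by [].
move: {2 3}256 => B B256.
rewrite leqNgt; apply/negP => hc.
have n1 : 1 < n by exact: leq_trans n24.
have n0 : 0 < n by exact: ltnW.
have [|delta hdelta dc] := exists_degree_threshold k0 n1 _ hc.
  by apply: (@leq_trans 256).
suff : 2 * delta * n ^ 3 < \sum_x #|[set y | energy_edge chi x y]|.
  by move/bound; rewrite leqNgt hdelta.
(* The loss of 64 per colour class is then below n^2 / 4. The diagonal costs at most n^2 / 4 too, so
   half of n^2 survives in [S1n]. *)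
have cn : 256 * c < n ^ 2.
  have : (256 * c) ^ 8 < (n ^ 2) ^ 8; last by rewrite ltn_exp2r.
  apply: (@leq_ltn_trans (B ^ 8 * (kappa ^ 4 * c ^ 8))).
    rewrite expnMn; apply: leq_mul; first by rewrite leq_exp2r.
    by rewrite leq_pmull // expn_gt0 k0.
  apply: leq_trans hc _; rewrite -expnM leq_exp2l //.
apply: leq_trans (card_energy_edges n24 kl).
rewrite ltnNge; apply/negP => few.
have cube := sum_cube_le (fun q => #|color_class chi q| - 64).
have tot : n * n - n <= \sum_q (#|color_class chi q| - 64) + 64 * c.
  rewrite -(sum_color_class chi) -[c in 64 * c]card_ord mulnC -sum_nat_const -big_split /=.
  by apply: leq_sum => q _; lia.
move: cube few tot; rewrite card_ord.
move: (\sum_q _) (\sum_q _) => S3 S1 cube few tot.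
have S1n : n ^ 2 <= 2 * S1.
  have nn : 4 * n <= n ^ 2 by rewrite expnS expn1 leq_mul2r (leq_trans _ n24) ?orbT.
  by move: tot nn cn; rewrite -[n * n]/(n ^ 2); move: (n ^ 2) => n2; lia.
have : n ^ 6 < n ^ 6; last by rewrite ltnn.
(* The chain is n^6 <= 8 S1^3 <= 8 c^2 S3 <= 16 delta c^2 n^3 < n^6. *)
apply: (@leq_ltn_trans ((2 * S1) ^ 3)).
  by rewrite -[6]/(2 * 3) expnM leq_exp2r.
apply: (@leq_ltn_trans (8 * (c ^ 2 * (2 * delta * n ^ 3)))).
  rewrite expnMn leq_mul2l /=; apply: leq_trans cube _.
  by rewrite leq_mul2l few orbT.
rewrite (_ : 8 * _ = 16 * delta * c ^ 2 * n ^ 3); last by lia.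
by rewrite -[6]/(3 + 3) expnD ltn_pmul2r // expn_gt0 n0.
Qed.

Lemma find_iota0 (P : pred nat) m :
  find P (iota 0 m) < m -> P (find P (iota 0 m)).
Proof.
move=> lt; rewrite -[X in P X]add0n -(nth_iota 0 0 lt).
by apply: nth_find; rewrite has_find size_iota.
Qed.

Lemma fnkl_lower_bound : exists2 K, 1 < K &
  forall n, 24 <= n -> n ^ 9 <= K * fnkl n 24 ('C(24, 2) - 15) ^ 8.
Proof.
have k0 : 0 < 64 ^ 2 * (9 * 16 ^ 3) by rewrite muln_gt0 expn_gt0 muln_gt0 expn_gt0.
move: (64 ^ 2 * (9 * 16 ^ 3)) k0 good_lower_bound => kappa k0.
have : 1 < 256 ^ 8 by apply: (@leq_trans (256 ^ 1)); rewrite ?leq_exp2l.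
move: (256 ^ 8) => M M1 bound.
have K1 : 1 < M * kappa ^ 4.
  by apply: leq_trans M1 _; rewrite leq_pmulr // expn_gt0 k0.
exists (M * kappa ^ 4) => // n n24.
have [lt|ge] := ltnP (fnkl n 24 ('C(24, 2) - 15)) (n * n).+1.
  rewrite -mulnA; apply: bound => //; exact: find_iota0 lt.
(* An unsuccessful search returns [(n * n).+1], which already exceeds n^2 and so satisfies the
   bound. *)
apply: (@leq_trans ((n ^ 2) ^ 8)).
  by rewrite -expnM leq_exp2l // (leq_trans _ n24).
apply: (@leq_trans (fnkl n 24 ('C(24, 2) - 15) ^ 8)); first by rewrite leq_exp2r // ltnW.
by rewrite leq_pmull // ltnW.
Qed.

(* From integer powers to the real exponent 9/8 *)
From Stdlib Require Import Reals Lra.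
(* Makes [^] on nat mean [expn] again, which Reals changed to [Nat.pow]. *)
From mathcomp Require Import ssrnat.

Lemma INR_expn m k : INR (m ^ k) = (INR m ^ k)%R.
Proof. by elim: k => [|k IH] //; rewrite expnS mult_INR IH. Qed.

(** Compare eighth powers. The constant 1/K in place of K^(-1/8) avoids a root, and K >= 2 leaves a
    factor 2^(-7) that makes the contradiction strict. *)
Lemma Rpower_le_of_expn (K n m : nat) :
    1 < K -> 0 < n -> n ^ 9 <= K * m ^ 8 ->
  (/ INR K * Rpower (INR n) (9 / 8) <= INR m)%R.
Proof.
move=> K0 n0 h.
have K1 : (2 <= INR K)%R by rewrite -[2%R]/(INR 2); apply: le_INR; lia.
have n0R : (0 < INR n)%R by apply: lt_0_INR; lia.
apply: Rnot_lt_le => lt.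
have hR : (INR n ^ 9 <= INR K * INR m ^ 8)%R.
  by rewrite -!INR_expn -mult_INR; apply: le_INR; apply/leP.
have r8 : (Rpower (INR n) (9 / 8) ^ 8 = INR n ^ 9)%R.
  rewrite -!Rpower_pow //; last exact: exp_pos.
  rewrite Rpower_mult; congr Rpower.
  by rewrite /=; Lra.lra.
have m0 : (0 <= INR m)%R by exact: pos_INR.
have : (INR m ^ 8 <= (/ INR K) ^ 8 * INR n ^ 9)%R.
  by rewrite -r8 -Rpow_mult_distr; apply: pow_incr; split=> //; exact: Rlt_le.
have : (INR K * / INR K = 1)%R by apply: Rinv_r; Lra.lra.
have k0 : (0 < / INR K)%R by apply: Rinv_0_lt_compat; Lra.lra.
have k2 : (/ INR K <= / 2)%R by apply: Rinv_le_contravar; Lra.lra.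
have k7 : ((/ INR K) ^ 7 <= (/ 2) ^ 7)%R by apply: pow_incr; Lra.lra.
have N9 : (0 < INR n ^ 9)%R by exact: pow_lt.
move: (/ INR K)%R (INR n ^ 9)%R (INR m ^ 8)%R k0 k2 k7 N9 hR => k N M k0 k2 k7 N0 hR Kk le8.
have : (INR K * M <= k ^ 7 * N)%R.
  rewrite (_ : k ^ 7 * N = INR K * (k ^ 8 * N))%R.
    by apply: Rmult_le_compat_l => //; Lra.lra.
  by rewrite -(tech_pow_Rmult k 7) (Rmult_assoc k) -(Rmult_assoc (INR K)) Kk Rmult_1_l.
have : (k ^ 7 * N <= (/ 2) ^ 7 * N)%R by apply: Rmult_le_compat_r; Lra.lra.
by Lra.lra.
Qed.

(* f(n, 24, C(24,2) - 15) = Omega(n^(9/8)) *)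
Theorem theorem1p3 :
  exists C : R, (0 < C)%R /\
  exists N : nat, forall n : nat, (N <= n)%coq_nat ->
    (C * Rpower (INR n) (9 / 8) <= INR (fnkl n 24 ('C(24, 2) - 15)))%R.
Proof.
have [K K1 bound] := fnkl_lower_bound.
have K0 : (0 < INR K)%R by apply: lt_0_INR; lia.
exists (/ INR K)%R; split; first exact: Rinv_0_lt_compat.
exists 24 => n /leP n24; apply: Rpower_le_of_expn => //; first exact: leq_trans n24.
exact: bound.
Qed.
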